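(* The (well-defined) functors $\rho\colon\mathbf{Fin}_{\mathsf{M^+Grz}}\to\mathbf{Fin}_{\mathsf{M^+IPC}}$ and $\sigma\colon\mathbf{Fin}_{\mathsf{M^+IPC}}\to\mathbf{Fin}_{\mathsf{M^+Grz}}$ yield an equivalence of the categories $\mathbf{Fin}_{\mathsf{M^+Grz}}$ and $\mathbf{Fin}_{\mathsf{M^+IPC}}$.
   Context: **Notation.** For a binary relation $R$ on $X$ and $U\subseteq X$, $R[U]$ is the $R$-image and $R^{-1}[U]$ the $R$-inverse image of $U$; $R[x]=R[\{x\}]$, $R^{-1}[x]=R^{-1}[\{x\}]$. $U$ is an $R$-upset if $R[U]\subseteq U$. For a quasi-order $R$, $E_R$ is the equivalence relation $x\,E_R\,y\iff x\,R\,y$ and $y\,R\,x$. A p-morphism $f\colon(X_1,R_1)\to(X_2,R_2)$ is a map with $R_2[f(x)]=fR_1[x]$ for all $x\in X_1$. **Finite $\mathsf{MIPC}$-frames.** A finite $\mathsf{MIPC}$-frame is $\mathfrak F=(X,R,Q)$ with $X$ a finite set, $R$ a partial order, $Q$ a quasi-order, $R\subseteq Q$, $Q[U]$ an $R$-upset for every $R$-upset $U$, and: $x\,Q\,y$ implies there is $z\in X$ with $x\,R\,z$ and $z\,E_Q\,y$. A morphism $f\colon(X_1,R_1,Q_1)\to(X_2,R_2,Q_2)$ of such frames is a map that is a p-morphism with respect to $R$ and with respect to $Q$ and satisfies $Q_2^{-1}[f(x)]=R_2^{-1}fQ_1^{-1}[x]$ for each $x\in X_1$. Formulas of the language $\mathcal{L}_{\forall\exists}$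 (connectives $\wedge,\vee,\to,\neg$ and modalities $\forall,\exists$) are interpreted under valuations $v$ assigning an $R$-upset to each propositional letter: intuitionistic connectives as in the Kripke semantics of $(X,R)$; $x\vDash_v\forall\varphi$ iff $y\vDash_v\varphi$ for all $y$ with $x\,Q\,y$; $x\vDash_v\exists\varphi$ iff $y\vDash_v\varphi$ for some $y$ with $x\,E_Q\,y$. A formula is valid on $\mathfrak F$ if it holds at every point under every valuation; $\mathfrak F$ is an $\mathsf L$-frame if all formulas of $\mathsf L$ are valid on it. **Finite $\mathsf{MS4}$-frames.** A finite $\mathsf{MS4}$-frame is $\mathfrak G=(Y,R,E)$ with $Y$ a finite set, $R$ a quasi-order, $E$ an equivalence relation, such that $x\,E\,y$ and $y\,R\,z$ imply there is $u\in Y$ with $x\,R\,u$ and $u\,E\,z$. A morphism of such frames is a map that is a p-morphism with respect to both $R$ and $E$. Formulas of $\mathcal{L}_{\Box\forall}$ (classical connectives, $\Box$, $\forall$, with $\exists=\neg\forall\neg$) are interpreted under valuations assigning arbitrary subsets to propositional letters, with $\Box$ interpreted by $R$ and $\forall$ by $E$ as universal modalities. Validity and being an $\mathsf M$-frame are defined as before. **Logics.** $\mathsf{MIPC}$ is the smallest set of $\mathcal{L}_{\forall\exists}$-formulas containing all theorems of intuitionistic propositional calculus, $\forall(p\land q)\leftrightarrow(\forall p\land\forall q)$, $\forall p\to p$, $\forall p\to\forall\forall p$, $\exists(p\vee q)\leftrightarrow(\exists p\vee\exists q)$, $p\to\exists p$, $\exists\exists p\to\exists p$, $(\exists p\land\exists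 q)\to\exists(\exists p\land q)$, $\exists\forall p\leftrightarrow\forall p$, $\exists p\leftrightarrow\forall\exists p$, and closed under modus ponens, substitution and $\forall$-necessitation. $\mathsf{M^+IPC}$ is obtained by adding to $\mathsf{MIPC}$ the monadic Casari formula $\forall((p\to\forall p)\to\forall p)\to\forall p$ (closing under the same rules). $\mathsf{MS4}$ is the smallest set of $\mathcal{L}_{\Box\forall}$-formulas containing all classical tautologies, the $\mathsf{S4}$-axioms for $\Box$, the $\mathsf{S5}$-axioms for $\forall$, and $\Box\forall p\to\forall\Box p$, and closed under modus ponens, substitution, $\Box$- and $\forall$-necessitation. $\mathsf{MGrz}$ is obtained by adding to $\mathsf{MS4}$ the axiom $\Box(\Box(p\to\Box p)\to p)\to p$, and $\mathsf{M^+Grz}$ by adding to $\mathsf{MGrz}$ the Gödel translation of the monadic Casari formula (closing under the same rules), where the Gödel translation is $p^t=\Box p$ for letters, commutes with $\wedge,\vee$, and $(\varphi\to\psi)^t=\Box(\varphi^t\to\psi^t)$, $(\neg\varphi)^t=\Box\neg\varphi^t$, $(\forall\varphi)^t=\Box\forall\varphi^t$, $(\exists\varphi)^t=\exists\varphi^t$. **Categories.** $\mathbf{Fin}_{\mathsf{M^+IPC}}$ is the category of finite $\mathsf{MIPC}$-frames that are $\mathsf{M^+IPC}$-frames, with all morphisms of finite $\mathsf{MIPC}$-frames between them. $\mathbf{Fin}_{\mathsf{M^+Grz}}$ is the category of finite $\mathsf{MS4}$-frames that are $\mathsf{M^+Grz}$-frames, with all morphisms of finite $\mathsf{MS4}$-frames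 between them. **Functors.** For $\mathfrak G=(Y,R,E)$ let $x\,Q_E\,y\iff\exists z\,(x\,R\,z$ and $z\,E\,y)$. The skeleton is $\rho\mathfrak G=(X,R',Q')$, where $X=Y/E_R$ with quotient map $\pi\colon Y\to X$, $\pi(x)\,R'\,\pi(y)\iff x\,R\,y$, and $\pi(x)\,Q'\,\pi(y)\iff x\,Q_E\,y$; for a morphism $f\colon\mathfrak G_1\to\mathfrak G_2$, $\rho(f)(\pi_1(x))=\pi_2(f(x))$. For a finite $\mathsf{MIPC}$-frame $\mathfrak F=(X,R,Q)$, $\sigma\mathfrak F=(X,R,E_Q)$, and $\sigma f=f$ on morphisms. *)

(* Defs.v *)
From HB Require Import structures.
From mathcomp Require Import all_boot.

Set Implicit Arguments.
Unset Strict Implicit.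
Unset Printing Implicit Defensive.

Section Relations.
Variable X : finType.
Implicit Types (R : rel X) (U : {set X}).

Definition rimage R U : {set X} := [set y | [exists x in U, R x y]].
Definition rpreimage R U : {set X} := [set x | [exists y in U, R x y]].

Definition upset R U : bool := rimage R U \subset U.

Definition cluster R : rel X := [rel x y | R x y && R y x].

Definition quasi_order R : Prop := reflexive R /\ transitive R.
Definition partial_order R : Prop := [/\ reflexive R, antisymmetric R & transitive R].
Definition equivalence R : Prop := [/\ reflexive R, symmetric R & transitive R].
End Relations.

Definition p_morphism (X1 X2 : finType) (R1 : rel X1) (R2 : rel X2)
    (f : {ffun X1 -> X2}) : bool :=
  [forall x, rimage R2 [set f x] == f @: rimage R1 [set x]].

(* Formulas whose unary modalities are indexed by M; propositional formulas
   are obtained with M := void. *)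
Inductive form (M : Type) : Type :=
  | Var of nat
  | And of form M & form M
  | Or of form M & form M
  | Imp of form M & form M
  | Neg of form M
  | Mod of M & form M.

Arguments Var {M} _.

Declare Scope fml_scope.
Delimit Scope fml_scope with F.
Bind Scope fml_scope with form.
Notation "a && b" := (And a b) : fml_scope.
Notation "a || b" := (Or a b) : fml_scope.
Notation "a ==> b" := (Imp a b) : fml_scope.
Notation "~~ a" := (Neg a) : fml_scope.
Notation "a <==> b" := (And (Imp a b) (Imp b a))
  (at level 56, no associativity) : fml_scope.

Fixpoint subst M (s : nat -> form M) (a : form M) : form M :=
  match a with
  | Var n => s n
  | And b c => And (subst s b) (subst s c)
  | Or b c => Or (subst s b) (subst s c)
  | Imp b c => Imp (subst s b) (subst s c)
  | Neg b => Neg (subst s b)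
  | Mod m b => Mod m (subst s b)
  end.

Fixpoint of_prop M (a : form void) : form M :=
  match a with
  | Var n => Var n
  | And b c => And (of_prop M b) (of_prop M c)
  | Or b c => Or (of_prop M b) (of_prop M c)
  | Imp b c => Imp (of_prop M b) (of_prop M c)
  | Neg b => Neg (of_prop M b)
  | Mod m _ => match m with end
  end.

Inductive imod : Type := IForall | IExists.
Inductive mmod : Type := MBox | MForall.

Definition iform := form imod.
Definition mform := form mmod.
Bind Scope fml_scope with iform.
Bind Scope fml_scope with mform.

Definition iall (a : iform) : iform := Mod IForall a.
Definition iex (a : iform) : iform := Mod IExists a.
Definition box (a : mform) : mform := Mod MBox a.
Definition mall (a : mform) : mform := Mod MForall a.
Definition mex (a : mform) : mform := Neg (mall (Neg a)).

Fixpoint goedel (a : iform) : mform :=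
  match a with
  | Var n => box (Var n)
  | And b c => And (goedel b) (goedel c)
  | Or b c => Or (goedel b) (goedel c)
  | Imp b c => box (Imp (goedel b) (goedel c))
  | Neg b => box (Neg (goedel b))
  | Mod IForall b => box (mall (goedel b))
  | Mod IExists b => mex (goedel b)
  end.

(* Kleene's Hilbert-style calculus, in which negation is primitive. *)
Inductive IPC : form void -> Prop :=
  | IPC_K a b : IPC (a ==> (b ==> a))
  | IPC_S a b c : IPC ((a ==> (b ==> c)) ==> ((a ==> b) ==> (a ==> c)))
  | IPC_andI a b : IPC (a ==> (b ==> (a && b)))
  | IPC_andEl a b : IPC ((a && b) ==> a)
  | IPC_andEr a b : IPC ((a && b) ==> b)
  | IPC_orIl a b : IPC (a ==> (a || b))
  | IPC_orIr a b : IPC (b ==> (a || b))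
  | IPC_orE a b c : IPC ((a ==> c) ==> ((b ==> c) ==> ((a || b) ==> c)))
  | IPC_negI a b : IPC ((a ==> b) ==> ((a ==> ~~ b) ==> ~~ a))
  | IPC_negE a b : IPC (~~ a ==> (a ==> b))
  | IPC_MP a b : IPC (a ==> b) -> IPC a -> IPC b.

Fixpoint truth_value (v : nat -> bool) (a : form void) : bool :=
  match a with
  | Var n => v n
  | And b c => truth_value v b && truth_value v c
  | Or b c => truth_value v b || truth_value v c
  | Imp b c => truth_value v b ==> truth_value v c
  | Neg b => ~~ truth_value v b
  | Mod m _ => match m with end
  end.

Definition tautology (a : form void) : Prop := forall v, truth_value v a.

(* The smallest set containing A and closed under modus ponens, substitution,
   and necessitation for the modalities selected by nec. *)
Inductive closure M (nec : pred M) (A : form M -> Prop) : form M -> Prop :=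
  | closure_ax a : A a -> closure nec A a
  | closure_MP a b : closure nec A (a ==> b)%F -> closure nec A a -> closure nec A b
  | closure_subst s a : closure nec A a -> closure nec A (subst s a)
  | closure_nec m a : nec m -> closure nec A a -> closure nec A (Mod m a).

Definition inec : pred imod := fun m => if m is IForall then true else false.
Definition mnec : pred mmod := predT.

Inductive MIPC_axiom : iform -> Prop :=
  | MIPC_IPC a : IPC a -> MIPC_axiom (of_prop imod a)
  | MIPC_allD (p := Var 0) (q := Var 1) :
      MIPC_axiom (iall (p && q) <==> (iall p && iall q))
  | MIPC_allE (p := Var 0) : MIPC_axiom (iall p ==> p)
  | MIPC_all4 (p := Var 0) : MIPC_axiom (iall p ==> iall (iall p))
  | MIPC_exD (p := Var 0) (q := Var 1) :
      MIPC_axiom (iex (p || q) <==> (iex p || iex q))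
  | MIPC_exI (p := Var 0) : MIPC_axiom (p ==> iex p)
  | MIPC_ex4 (p := Var 0) : MIPC_axiom (iex (iex p) ==> iex p)
  | MIPC_exM (p := Var 0) (q := Var 1) :
      MIPC_axiom ((iex p && iex q) ==> iex (iex p && q))
  | MIPC_exall (p := Var 0) : MIPC_axiom (iex (iall p) <==> iall p)
  | MIPC_allex (p := Var 0) : MIPC_axiom (iex p <==> iall (iex p)).

Definition MIPC : iform -> Prop := closure inec MIPC_axiom.

Definition casari : iform :=
  let p := Var 0 in (iall ((p ==> iall p) ==> iall p) ==> iall p)%F.

Definition MpIPC : iform -> Prop :=
  closure inec (fun a => MIPC a \/ a = casari).

Inductive MS4_axiom : mform -> Prop :=
  | MS4_taut a : tautology a -> MS4_axiom (of_prop mmod a)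
  | MS4_boxK (p := Var 0) (q := Var 1) :
      MS4_axiom (box (p ==> q) ==> (box p ==> box q))
  | MS4_boxT (p := Var 0) : MS4_axiom (box p ==> p)
  | MS4_box4 (p := Var 0) : MS4_axiom (box p ==> box (box p))
  | MS4_allK (p := Var 0) (q := Var 1) :
      MS4_axiom (mall (p ==> q) ==> (mall p ==> mall q))
  | MS4_allT (p := Var 0) : MS4_axiom (mall p ==> p)
  | MS4_all4 (p := Var 0) : MS4_axiom (mall p ==> mall (mall p))
  | MS4_all5 (p := Var 0) : MS4_axiom (mex p ==> mall (mex p))
  | MS4_boxall (p := Var 0) : MS4_axiom (box (mall p) ==> mall (box p)).

Definition MS4 : mform -> Prop := closure mnec MS4_axiom.

Definition grz : mform :=
  let p := Var 0 in (box (box (p ==> box p) ==> p) ==> p)%F.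

Definition MGrz : mform -> Prop :=
  closure mnec (fun a => MS4 a \/ a = grz).

Definition MpGrz : mform -> Prop :=
  closure mnec (fun a => MGrz a \/ a = goedel casari).

(* The second relation is Q for MIPC-frames and E for MS4-frames. *)
Record frame := Frame { world :> finType; relR : rel world; rel2 : rel world }.

Definition mipc_frame (F : frame) : Prop :=
  let R := @relR F in let Q := @rel2 F in
  [/\ partial_order R, quasi_order Q, subrel R Q,
      (forall U, upset R U -> upset R (rimage Q U))
    & (forall x y, Q x y -> exists z, R x z /\ cluster Q z y)].

Definition ms4_frame (G : frame) : Prop :=
  let R := @relR G in let E := @rel2 G in
  [/\ quasi_order R, equivalence E
    & (forall x y z, E x y -> R y z -> exists u, R x u /\ E u z)].

Fixpoint isat (F : frame) (v : nat -> {set F}) (a : iform) (x : F) : bool :=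
  match a with
  | Var n => x \in v n
  | And b c => isat v b x && isat v c x
  | Or b c => isat v b x || isat v c x
  | Imp b c => [forall y, relR x y ==> isat v b y ==> isat v c y]
  | Neg b => [forall y, relR x y ==> ~~ isat v b y]
  | Mod IForall b => [forall y, rel2 x y ==> isat v b y]
  | Mod IExists b => [exists y, cluster (@rel2 F) x y && isat v b y]
  end.

Definition ivalid (F : frame) (a : iform) : Prop :=
  forall v : nat -> {set F}, (forall n, upset (@relR F) (v n)) ->
  forall x, isat v a x.

Fixpoint msat (G : frame) (v : nat -> {set G}) (a : mform) (x : G) : bool :=
  match a with
  | Var n => x \in v n
  | And b c => msat v b x && msat v c x
  | Or b c => msat v b x || msat v c x
  | Imp b c => msat v b x ==> msat v c x
  | Neg b => ~~ msat v b x
  | Mod MBox b => [forall y, relR x y ==> msat v b y]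
  | Mod MForall b => [forall y, rel2 x y ==> msat v b y]
  end.

Definition mvalid (G : frame) (a : mform) : Prop :=
  forall (v : nat -> {set G}) x, msat v a x.

Definition mipc_frame_of (L : iform -> Prop) (F : frame) : Prop :=
  mipc_frame F /\ forall a, L a -> ivalid F a.

Definition ms4_frame_of (L : mform -> Prop) (G : frame) : Prop :=
  ms4_frame G /\ forall a, L a -> mvalid G a.

Definition mipc_morphism (F1 F2 : frame) (f : {ffun F1 -> F2}) : bool :=
  [&& p_morphism (@relR F1) (@relR F2) f,
      p_morphism (@rel2 F1) (@rel2 F2) f
    & [forall x, rpreimage (@rel2 F2) [set f x] ==
         rpreimage (@relR F2) (f @: rpreimage (@rel2 F1) [set x])]].

Definition ms4_morphism (G1 G2 : frame) (f : {ffun G1 -> G2}) : bool :=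
  p_morphism (@relR G1) (@relR G2) f && p_morphism (@rel2 G1) (@rel2 G2) f.

Record category := Category {
  obj :> Type;
  hom : obj -> obj -> Type;
  idm : forall a, hom a a;
  comp : forall a b c, hom b c -> hom a b -> hom a c;
  comp1m : forall a b (f : hom a b), comp (idm b) f = f;
  compm1 : forall a b (f : hom a b), comp f (idm a) = f;
  compA : forall a b c d (h : hom c d) (g : hom b c) (f : hom a b),
    comp h (comp g f) = comp (comp h g) f }.

Arguments hom {_} _ _.
Arguments idm {_} _.
Arguments comp {_ _ _ _} _ _.

Record functor (C D : category) (F0 : C -> D) := Functor {
  fmap : forall a b : C, hom a b -> hom (F0 a) (F0 b);
  fmap_id : forall a, fmap (idm a) = idm (F0 a);
  fmap_comp : forall a b c (g : hom b c) (f : hom a b),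
    fmap (comp g f) = comp (fmap g) (fmap f) }.

Arguments functor : clear implicits.
Arguments fmap {C D F0} _ {a b} _.

Definition functor_id (C : category) : functor C C id :=
  @Functor C C id (fun _ _ f => f) (fun _ => erefl) (fun _ _ _ _ _ => erefl).

Lemma functor_comp_id (C D E : category) (G0 : D -> E) (F0 : C -> D)
    (G : functor D E G0) (F : functor C D F0) (a : C) :
  fmap G (fmap F (idm a)) = idm (G0 (F0 a)).
Proof. by rewrite !fmap_id. Qed.

Lemma functor_comp_comp (C D E : category) (G0 : D -> E) (F0 : C -> D)
    (G : functor D E G0) (F : functor C D F0) (a b c : C)
    (g : hom b c) (f : hom a b) :
  fmap G (fmap F (comp g f)) = comp (fmap G (fmap F g)) (fmap G (fmap F f)).
Proof. by rewrite !fmap_comp. Qed.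

Definition functor_comp (C D E : category) (G0 : D -> E) (F0 : C -> D)
    (G : functor D E G0) (F : functor C D F0) : functor C E (G0 \o F0) :=
  @Functor C E (G0 \o F0) (fun _ _ f => fmap G (fmap F f))
    (functor_comp_id G F) (functor_comp_comp G F).

Definition isomorphism (C : category) (a b : C) (f : hom a b) : Prop :=
  exists g : hom b a, comp g f = idm a /\ comp f g = idm b.

Definition naturally_isomorphic (C D : category) (F0 G0 : C -> D)
    (F : functor C D F0) (G : functor C D G0) : Prop :=
  exists eta : forall a, hom (F0 a) (G0 a),
    (forall a, isomorphism (eta a)) /\
    (forall a b (f : hom a b), comp (eta b) (fmap F f) = comp (fmap G f) (eta a)).

Definition equivalence_of_categories (C D : category) (F0 : C -> D) (G0 : D -> C)
    (F : functor C D F0) (G : functor D C G0) : Prop :=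
  naturally_isomorphic (functor_comp G F) (functor_id C) /\
  naturally_isomorphic (functor_comp F G) (functor_id D).

Lemma rimage1P (X : finType) (R : rel X) (x y : X) :
  (y \in rimage R [set x]) = R x y.
Proof.
rewrite inE; apply/existsP/idP => [[z /andP[/set1P -> //]]|Rxy].
by exists x; rewrite set11.
Qed.

Lemma rpreimage1P (X : finType) (R : rel X) (x y : X) :
  (y \in rpreimage R [set x]) = R y x.
Proof.
rewrite inE; apply/existsP/idP => [[z /andP[/set1P -> //]]|Rxy].
by exists x; rewrite set11.
Qed.

Lemma p_morphismP (X1 X2 : finType) (R1 : rel X1) (R2 : rel X2)
    (f : {ffun X1 -> X2}) :
  reflect ((forall x y, R1 x y -> R2 (f x) (f y)) /\
           (forall x z, R2 (f x) z -> exists2 y, R1 x y & z = f y))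
          (p_morphism R1 R2 f).
Proof.
apply: (iffP forallP) => [H|[H1 H2] x].
  split=> x y Rxy; move/eqP/setP: (H x) => /(_ _) Hx.
    by rewrite -rimage1P Hx; apply: imset_f; rewrite rimage1P.
  move: (Hx y); rewrite rimage1P Rxy => /esym/imsetP[z].
  by rewrite rimage1P => Rxz ->; exists z.
apply/eqP/setP=> z; rewrite rimage1P; apply/idP/imsetP.
  by move/H2=> [y Rxy ->]; exists y; rewrite ?rimage1P.
by case=> y; rewrite rimage1P => Rxy ->; apply: H1.
Qed.

Lemma p_morphism_id (X : finType) (R : rel X) :
  p_morphism R R [ffun x => x].
Proof.
by apply/p_morphismP; split=> x y; rewrite !ffunE // => Rxy; exists y; rewrite ?ffunE.
Qed.

Lemma p_morphism_comp (X1 X2 X3 : finType) (R1 : rel X1) (R2 : rel X2)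
    (R3 : rel X3) (g : {ffun X2 -> X3}) (f : {ffun X1 -> X2}) :
  p_morphism R2 R3 g -> p_morphism R1 R2 f ->
  p_morphism R1 R3 [ffun x => g (f x)].
Proof.
move=> /p_morphismP[g1 g2] /p_morphismP[f1 f2]; apply/p_morphismP; split=> x y.
  by rewrite !ffunE => /f1/g1.
rewrite ffunE => /g2[z /f2[w Rxw ->] ->]; exists w => //; by rewrite ffunE.
Qed.

Lemma mipc_morphism_id (F : frame) :
  mipc_frame F -> mipc_morphism [ffun x : F => x].
Proof.
case=> [[Rr _ _] [_ Qt] RQ _ _].
rewrite /mipc_morphism !p_morphism_id /=; apply/forallP=> x.
apply/eqP/setP=> y; rewrite rpreimage1P ffunE; apply/idP/idP.
  move=> Qyx; rewrite inE; apply/existsP; exists y; rewrite Rr andbT.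
  by apply/imsetP; exists y; rewrite ?ffunE ?rpreimage1P.
rewrite inE => /existsP[z /andP[/imsetP[w]]].
by rewrite rpreimage1P ffunE => Qwx -> /RQ Qyw; apply: Qt Qwx.
Qed.

Lemma mipc_morphism_comp (F1 F2 F3 : frame)
    (g : {ffun F2 -> F3}) (f : {ffun F1 -> F2}) :
  mipc_frame F2 -> mipc_frame F3 ->
  mipc_morphism g -> mipc_morphism f -> mipc_morphism [ffun x => g (f x)].
Proof.
move=> [[Rr2 _ _] _ _ _ _] [[_ _ Rt3] _ _ _ _].
move=> /and3P[gR gQ /forallP gI] /and3P[fR fQ /forallP fI].
rewrite /mipc_morphism (p_morphism_comp gR fR) (p_morphism_comp gQ fQ) /=.
apply/forallP=> x; rewrite ffunE (eqP (gI (f x))) (eqP (fI x)).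
apply/eqP/setP=> y; apply/idP/idP; rewrite !inE => /existsP[z /andP[/imsetP[w]]].
  rewrite inE => /existsP[u /andP[/imsetP[t tx ->] wft]] -> yz.
  apply/existsP; exists (g (f t)); apply/andP; split.
    by apply/imsetP; exists t; rewrite ?ffunE.
  by apply: Rt3 yz _; case/p_morphismP: gR => + _; apply.
rewrite ffunE => wx -> yw; apply/existsP; exists (g (f w)); rewrite yw andbT.
apply/imsetP; exists (f w) => //; rewrite inE; apply/existsP; exists (f w).
by rewrite Rr2 andbT imset_f.
Qed.

Lemma ms4_morphism_id (G : frame) : ms4_morphism [ffun x : G => x].
Proof. by rewrite /ms4_morphism !p_morphism_id. Qed.

Lemma ms4_morphism_comp (G1 G2 G3 : frame)
    (g : {ffun G2 -> G3}) (f : {ffun G1 -> G2}) :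
  ms4_morphism g -> ms4_morphism f -> ms4_morphism [ffun x => g (f x)].
Proof.
move=> /andP[g1 g2] /andP[f1 f2].
by rewrite /ms4_morphism (p_morphism_comp g1 f1) (p_morphism_comp g2 f2).
Qed.

Section Fin_MIPC.
Variable L : iform -> Prop.

Definition fin_mipc_obj : Type := {F : frame | mipc_frame_of L F}.
Implicit Types F : fin_mipc_obj.

Definition fin_mipc_hom F1 F2 : Type :=
  {f : {ffun sval F1 -> sval F2} | mipc_morphism f}.

Definition fin_mipc_id F : fin_mipc_hom F F :=
  exist (fun f => is_true (mipc_morphism f)) _ (mipc_morphism_id (proj1 (svalP F))).

Definition fin_mipc_comp F1 F2 F3 (g : fin_mipc_hom F2 F3)
    (f : fin_mipc_hom F1 F2) : fin_mipc_hom F1 F3 :=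
  exist (fun f => is_true (mipc_morphism f)) _
        (mipc_morphism_comp (proj1 (svalP F2)) (proj1 (svalP F3))
               (svalP g) (svalP f)).

Lemma fin_mipc_comp1m F1 F2 (f : fin_mipc_hom F1 F2) :
  fin_mipc_comp (fin_mipc_id F2) f = f.
Proof. by apply: val_inj; apply/ffunP=> x /=; rewrite !ffunE. Qed.

Lemma fin_mipc_compm1 F1 F2 (f : fin_mipc_hom F1 F2) :
  fin_mipc_comp f (fin_mipc_id F1) = f.
Proof. by apply: val_inj; apply/ffunP=> x /=; rewrite !ffunE. Qed.

Lemma fin_mipc_compA F1 F2 F3 F4 (h : fin_mipc_hom F3 F4)
    (g : fin_mipc_hom F2 F3) (f : fin_mipc_hom F1 F2) :
  fin_mipc_comp h (fin_mipc_comp g f) = fin_mipc_comp (fin_mipc_comp h g) f.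
Proof. by apply: val_inj; apply/ffunP=> x /=; rewrite !ffunE. Qed.

Definition Fin_MIPC : category :=
  Category fin_mipc_comp1m fin_mipc_compm1 fin_mipc_compA.
End Fin_MIPC.

Section Fin_MS4.
Variable L : mform -> Prop.

Definition fin_ms4_obj : Type := {G : frame | ms4_frame_of L G}.
Implicit Types G : fin_ms4_obj.

Definition fin_ms4_hom G1 G2 : Type :=
  {f : {ffun sval G1 -> sval G2} | ms4_morphism f}.

Definition fin_ms4_id G : fin_ms4_hom G G :=
  exist (fun f => is_true (ms4_morphism f)) _ (ms4_morphism_id (sval G)).

Definition fin_ms4_comp G1 G2 G3 (g : fin_ms4_hom G2 G3)
    (f : fin_ms4_hom G1 G2) : fin_ms4_hom G1 G3 :=
  exist (fun f => is_true (ms4_morphism f)) _ (ms4_morphism_comp (svalP g) (svalP f)).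

Lemma fin_ms4_comp1m G1 G2 (f : fin_ms4_hom G1 G2) :
  fin_ms4_comp (fin_ms4_id G2) f = f.
Proof. by apply: val_inj; apply/ffunP=> x /=; rewrite !ffunE. Qed.

Lemma fin_ms4_compm1 G1 G2 (f : fin_ms4_hom G1 G2) :
  fin_ms4_comp f (fin_ms4_id G1) = f.
Proof. by apply: val_inj; apply/ffunP=> x /=; rewrite !ffunE. Qed.

Lemma fin_ms4_compA G1 G2 G3 G4 (h : fin_ms4_hom G3 G4)
    (g : fin_ms4_hom G2 G3) (f : fin_ms4_hom G1 G2) :
  fin_ms4_comp h (fin_ms4_comp g f) = fin_ms4_comp (fin_ms4_comp h g) f.
Proof. by apply: val_inj; apply/ffunP=> x /=; rewrite !ffunE. Qed.

Definition Fin_MS4 : category :=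
  Category fin_ms4_comp1m fin_ms4_compm1 fin_ms4_compA.
End Fin_MS4.

Definition Fin_MpIPC : category := Fin_MIPC MpIPC.
Definition Fin_MpGrz : category := Fin_MS4 MpGrz.

Definition relQ (G : frame) : rel G :=
  [rel x y | [exists z, relR x z && rel2 z y]].

Section Skeleton.
Variable G : frame.

Definition R_classes : {set {set G}} :=
  equivalence_partition (cluster (@relR G)) [set: G].

Definition skeleton_world : finType := {A : {set G} | A \in R_classes}.

Definition R_class (x : G) : {set G} :=
  [set y in [set: G] | cluster (@relR G) x y].

Lemma R_class_in (x : G) : R_class x \in R_classes.
Proof. exact: imset_f. Qed.

Definition skeleton_proj (x : G) : skeleton_world :=
  exist (fun A => is_true (A \in R_classes)) (R_class x) (R_class_in x).

(* When S is compatible with E_R (as R and relQ are in an MS4-frame), this is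
   the relation characterised by pi(x) S' pi(y) <-> x S y; see skeleton_relR
   and skeleton_relQ. *)
Definition quotient_rel (S : rel G) : rel skeleton_world :=
  fun A B => [exists x in sval A, exists y in sval B, S x y].

Definition skeleton : frame :=
  @Frame skeleton_world (quotient_rel (@relR G)) (quotient_rel (@relQ G)).

Lemma quotient_relE (S : rel G) :
  reflexive (@relR G) ->
  (forall x x' y y', relR x' x -> relR y y' -> S x y -> S x' y') ->
  forall x y, quotient_rel S (skeleton_proj x) (skeleton_proj y) = S x y.
Proof.
move=> Rr HS x y; apply/existsP/idP => [[x' /andP[]]|Sxy].
  rewrite /= !inE /= => /andP[Rx _] /existsP[y' /andP[]].
  by rewrite !inE /= => /andP[_ Ry]; apply: HS.
exists x; rewrite /= !inE /cluster /= !Rr /=; apply/existsP; exists y.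
by rewrite !inE /cluster /= !Rr.
Qed.

Lemma skeleton_relR : ms4_frame G ->
  forall x y : G, @relR skeleton (skeleton_proj x) (skeleton_proj y) = relR x y.
Proof.
case=> [[Rr Rt] _ _]; apply: quotient_relE => // x x' y y' Rx Ry Rxy.
exact: Rt (Rt _ _ _ Rx Rxy) Ry.
Qed.

Lemma skeleton_relQ : ms4_frame G ->
  forall x y : G, @rel2 skeleton (skeleton_proj x) (skeleton_proj y) = relQ x y.
Proof.
case=> [[Rr Rt] [_ _ Et] RE]; apply: quotient_relE => // x x' y y' Rx Ry.
move=> /existsP[z /andP[Rxz Ezy]]; have [u [Rzu Euy]] := RE _ _ _ Ezy Ry.
by apply/existsP; exists u; rewrite Euy andbT; apply: Rt Rx (Rt _ _ _ Rxz Rzu).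
Qed.
End Skeleton.

Definition sigma_frame (F : frame) : frame :=
  @Frame F (@relR F) (cluster (@rel2 F)).

(* Main.v *)
(* On finite frames the monadic Casari formula says that a cluster of Q carries
   no nontrivial R-arrow, and Grzegorczyk's axiom that R is antisymmetric.
   Hence for a finite M+Grz-frame (Y, R, E) the projection onto the skeleton is
   an isomorphism from (Y, R, Q_E), and E is recovered as the cluster relation
   of Q_E; conversely Q_E = Q when E is the cluster relation of an M+IPC-frame.
   The two functors are therefore mutually inverse up to the relabelling of
   points by their singleton R-classes.  Cleanness of clusters is also what
   makes an MIPC-morphism a p-morphism for the cluster relations. *)
Require Import Defs.
From mathcomp Require Import all_boot.

Set Implicit Arguments.
Unset Strict Implicit.
Unset Printing Implicit Defensive.

(** * Maximal points of finite quasi-orders, upsets, soundness along closures *)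

(** Among the points of [P] above [x], take [y] with the fewest [S]-successors. If [z] in [P] is a
    successor of [y], the successors of [z] form a subset of those of [y] of at least the same size,
    hence the same set, and [y] belongs to it. *)
Lemma finite_maximal (X : finType) (S : rel X) (P : pred X) x :
  reflexive S -> transitive S -> P x ->
  exists2 y, P y /\ S x y & forall z, P z -> S y z -> S z y.
Proof.
move=> Sr St Px; have Pxx : P x && S x x by rewrite Px Sr.
case: (@arg_minnP _ x (fun y => P y && S x y) (fun y => #|[set z | S y z]|) Pxx).
move=> y /andP[Py Sxy] ymin; exists y => // z Pz Syz.
have sub : [set t | S z t] \subset [set t | S y t].
  by apply/subsetP=> t; rewrite !inE; apply: St.
have := ymin z; rewrite Pz (St _ _ _ Sxy Syz) => /(_ isT) le.
have /eqP/setP/(_ y) : [set t | S z t] == [set t | S y t] by rewrite eqEcard sub.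
by rewrite !inE Sr.
Qed.

Lemma upsetP (X : finType) (R : rel X) (U : {set X}) :
  reflect (forall x y, R x y -> x \in U -> y \in U) (upset R U).
Proof.
apply: (iffP subsetP) => [H x y Rxy xU|H y].
  by apply: H; rewrite inE; apply/existsP; exists x; rewrite xU.
by rewrite inE => /existsP[x /andP[xU Rxy]]; apply: H xU.
Qed.

Lemma closure_sound M (nec : pred M) (A V : form M -> Prop) :
  (forall a, A a -> V a) ->
  (forall a b, V (a ==> b)%F -> V a -> V b) ->
  (forall s a, V a -> V (subst s a)) ->
  (forall m a, nec m -> V a -> V (Mod m a)) ->
  forall a, Defs.closure nec A a -> V a.
Proof. by move=> AV mp sb nc a; elim=> *; eauto. Qed.

(** * Intuitionistic semantics and the frame condition of the monadic Casari formula *)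

Section IntuitionisticValidity.
Variable F : frame.
Implicit Types (v : nat -> {set F}) (a b c : iform) (x y z : F).

(** When [relR] is contained in [rel2], the two premises put [x] and [y] in one cluster of [rel2],
    so this forbids strict [relR]-arrows inside clusters. *)
Definition clean_clusters := forall x y, relR x y -> rel2 y x -> x = y.

Lemma isat_andP v b c x : reflect (isat v b x /\ isat v c x) (isat v (b && c)%F x).
Proof. exact: andP. Qed.

Lemma isat_orP v b c x : reflect (isat v b x \/ isat v c x) (isat v (b || c)%F x).
Proof. exact: orP. Qed.

Lemma isat_impP v b c x :
  reflect (forall y, relR x y -> isat v b y -> isat v c y) (isat v (b ==> c)%F x).
Proof.
apply: (iffP forallP) => H y.
  by move=> Rxy; apply/implyP/(implyP (H y)).
by apply/implyP=> Rxy; apply/implyP; apply: H.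
Qed.

Lemma isat_negP v b x :
  reflect (forall y, relR x y -> ~ isat v b y) (isat v (~~ b)%F x).
Proof.
apply: (iffP forallP) => H y.
  by move=> Rxy; apply/negP/(implyP (H y)).
by apply/implyP=> Rxy; apply/negP; apply: H.
Qed.

Lemma isat_iallP v b x :
  reflect (forall y, rel2 x y -> isat v b y) (isat v (iall b) x).
Proof.
apply: (iffP forallP) => H y; first exact: (implyP (H y)).
by apply/implyP; apply: H.
Qed.

Lemma isat_iexP v b x :
  reflect (exists y, [/\ rel2 x y, rel2 y x & isat v b y]) (isat v (iex b) x).
Proof.
by apply: (iffP existsP) => [[y /andP[/andP[? ?] ?]]|[y [? ? ?]]]; exists y => //;
  apply/andP; split=> //; apply/andP.
Qed.

Lemma eq_isat v1 v2 a : v1 =1 v2 -> isat v1 a =1 isat v2 a.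
Proof.
move=> E; elim: a => [n|a IHa b IHb|a IHa b IHb|a IHa b IHb|a IHa|[] a IHa] x /=.
- by rewrite E.
- by rewrite IHa IHb.
- by rewrite IHa IHb.
- by apply: eq_forallb => y; rewrite IHa IHb.
- by apply: eq_forallb => y; rewrite IHa.
- by apply: eq_forallb => y; rewrite IHa.
- by apply: eq_existsb => y; rewrite IHa.
Qed.

Lemma isat_subst v s a x :
  isat v (subst s a) x = isat (fun n => [set y | isat v (s n) y]) a x.
Proof.
elim: a x => [n|a IHa b IHb|a IHa b IHb|a IHa b IHb|a IHa|[] a IHa] x /=.
- by rewrite inE.
- by rewrite IHa IHb.
- by rewrite IHa IHb.
- by apply: eq_forallb => y; rewrite IHa IHb.
- by apply: eq_forallb => y; rewrite IHa.
- by apply: eq_forallb => y; rewrite IHa.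
- by apply: eq_existsb => y; rewrite IHa.
Qed.

Lemma ivalid_MP a b : reflexive (@relR F) ->
  ivalid F (a ==> b)%F -> ivalid F a -> ivalid F b.
Proof. by move=> Rr ab va v vU x; apply: (isat_impP _ _ _ _ (ab v vU x)); auto. Qed.

Hypothesis mF : mipc_frame F.

Let Rr : reflexive (@relR F). Proof. by case: mF => [[]]. Qed.
Let Rt : transitive (@relR F). Proof. by case: mF => [[]]. Qed.
Let Qr : reflexive (@rel2 F). Proof. by case: mF => _ []. Qed.
Let Qt : transitive (@rel2 F). Proof. by case: mF => _ []. Qed.
Let RQ x y : relR x y -> rel2 x y. Proof. by case: mF => _ _ RQ _ _; apply: RQ. Qed.
Let QRE x y : rel2 x y -> exists z, relR x z /\ cluster (@rel2 F) z y.
Proof. by case: mF => _ _ _ _; apply. Qed.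

Lemma isat_mono v a x y : (forall n, upset (@relR F) (v n)) ->
  relR x y -> isat v a x -> isat v a y.
Proof.
move=> vU; elim: a x y => [n|a IHa b IHb|a IHa b IHb|a _ b _|a _|[] a IHa] x y Rxy.
- by move/upsetP: (vU n) => /(_ _ _ Rxy).
- by case/andP=> /(IHa _ _ Rxy) /= -> /(IHb _ _ Rxy).
- by case/orP=> [/(IHa _ _ Rxy)|/(IHb _ _ Rxy)] /= ->; rewrite ?orbT.
- by move/isat_impP=> H; apply/isat_impP=> z /(Rt Rxy); apply: H.
- by move/isat_negP=> H; apply/isat_negP=> z /(Rt Rxy); apply: H.
- by move/isat_iallP=> H; apply/isat_iallP=> z /(Qt (RQ Rxy)); apply: H.
- move/isat_iexP=> [z [Qxz Qzx az]]; apply/isat_iexP.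
  (* The witness [z] lies in the cluster of [x] and so sees [y] by [rel2]; it can be moved up along
     [relR] into the cluster of [y], and the induction hypothesis carries the formula along. *)
  have [t [Rzt /andP[Qty Qyt]]] := QRE (Qt Qzx (RQ Rxy)).
  by exists t; split=> //; apply: IHa az.
Qed.

Lemma ivalid_subst s a : ivalid F a -> ivalid F (subst s a).
Proof.
move=> va v vU x; rewrite isat_subst; apply: va => n; apply/upsetP=> y z Ryz.
by rewrite !inE; apply: isat_mono.
Qed.

Lemma ivalid_nec m a : inec m -> ivalid F a -> ivalid F (Mod m a).
Proof. by case: m => // _ va v vU x; apply/isat_iallP=> y _; apply: va. Qed.

Lemma IPC_ivalid (a : form void) : IPC a -> ivalid F (of_prop imod a).
Proof.
elim=> {a} [a b|a b c|a b|a b|a b|a b|a b|a b c|a b|a b|a b _ IHab _ IHa];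
  last exact: ivalid_MP IHab IHa.
all: move=> v vU x.
- apply/isat_impP=> y _ ay; apply/isat_impP=> z Ryz _; exact: isat_mono ay.
- apply/isat_impP=> y _ /isat_impP abc; apply/isat_impP=> z Ryz /isat_impP ab.
  apply/isat_impP=> t Rzt at_; have /isat_impP bc := abc _ (Rt Ryz Rzt) at_.
  by apply: bc => //; apply: ab.
- apply/isat_impP=> y _ ay; apply/isat_impP=> z Ryz bz /=.
  by rewrite (isat_mono vU Ryz ay).
- by apply/isat_impP=> y _ /andP[].
- by apply/isat_impP=> y _ /andP[].
- by apply/isat_impP=> y _ /= ->.
- by apply/isat_impP=> y _ /= ->; rewrite orbT.
- apply/isat_impP=> y _ /isat_impP ac; apply/isat_impP=> z Ryz /isat_impP bc.
  apply/isat_impP=> t Rzt /orP[]; [apply: ac; exact: Rt Rzt | exact: bc].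
- apply/isat_impP=> y _ /isat_impP ab; apply/isat_impP=> z Ryz /isat_impP anb.
  apply/isat_negP=> t Rzt at_; have /isat_negP := anb _ Rzt at_; apply; first exact: Rr.
  by apply: ab at_; exact: Rt Rzt.
- apply/isat_impP=> y _ /isat_negP na; apply/isat_impP=> z Ryz az.
  by case: (na _ Ryz).
Qed.

Lemma MIPC_axiom_ivalid a : MIPC_axiom a -> ivalid F a.
Proof.
case=> {a} [a /IPC_ivalid //|p q|p|p|p q|p|p|p q|p|p] v vU x.
- apply/isat_andP; split; apply/isat_impP=> y _.
    move/isat_iallP=> H; apply/isat_andP; split; apply/isat_iallP=> z Qyz;
      by case/isat_andP: (H _ Qyz).
  case/isat_andP=> /isat_iallP Hp /isat_iallP Hq; apply/isat_iallP=> z Qyz.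
  by apply/isat_andP; split; [exact: Hp|exact: Hq].
- by apply/isat_impP=> y _ /isat_iallP; apply.
- apply/isat_impP=> y _ /isat_iallP H; apply/isat_iallP=> z Qyz.
  by apply/isat_iallP=> t /(Qt Qyz); apply: H.
- apply/isat_andP; split; apply/isat_impP=> y _.
    case/isat_iexP=> z [Qyz Qzy /isat_orP[] H]; apply/isat_orP; [left|right];
      by apply/isat_iexP; exists z.
  by case/isat_orP=> /isat_iexP[z [Qyz Qzy H]]; apply/isat_iexP; exists z;
    split=> //; apply/isat_orP; [left|right].
- by apply/isat_impP=> y _ py; apply/isat_iexP; exists y; split.
- apply/isat_impP=> y _ /isat_iexP[z [Qyz Qzy /isat_iexP[t [Qzt Qtz pt]]]].
  apply/isat_iexP; exists t; split=> //; [exact: Qt Qzt|exact: Qt Qzy].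
- apply/isat_impP=> y _ /isat_andP[/isat_iexP[z [Qyz Qzy pz]] /isat_iexP[t [Qyt Qty qt]]].
  apply/isat_iexP; exists t; split=> //; apply/isat_andP; split=> //.
  by apply/isat_iexP; exists z; split=> //; [exact: Qt Qyz|exact: Qt Qyt].
- apply/isat_andP; split; apply/isat_impP=> y _.
    case/isat_iexP=> z [Qyz Qzy /isat_iallP H]; apply/isat_iallP=> t Qyt.
    by apply: H; exact: Qt Qyt.
  by move=> H; apply/isat_iexP; exists y; split.
- apply/isat_andP; split; apply/isat_impP=> y _.
    case/isat_iexP=> z [Qyz Qzy pz]; apply/isat_iallP=> t Qyt; apply/isat_iexP.
    have [u [Rzu /andP[Qut Qtu]]] := QRE (Qt Qzy Qyt).
    by exists u; split=> //; apply: isat_mono pz.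
  by move/isat_iallP; apply.
Qed.

(** If p failed somewhere above [w], let [u] be a [rel2]-maximal failure. Suppose [u'] is an
    [relR]-successor of [u] where p holds and [t] a failure seen from [u']. Maximality brings [t]
    back to [u], so [u'] is in the cluster of [u] and equals [u] by cleanness, which is absurd.
    Hence [u] satisfies the inner premise, and the hypothesis forces p at [u]. *)
Lemma casari_ivalid : clean_clusters -> ivalid F casari.
Proof.
move=> cl v vU x; apply/isat_impP=> w _ /isat_iallP H; apply/isat_iallP=> u0 Qwu0.
apply/negPn/negP=> nu0.
have [u [nu Qu0u] umax] := finite_maximal (P := fun u => ~~ isat v (Var 0) u) Qr Qt nu0.
have /isat_impP Hu := H _ (Qt Qwu0 Qu0u).
have /isat_iallP : isat v (iall (Var 0)) u; last by move/(_ _ (Qr u)); apply/negP.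
apply: Hu => //; apply/isat_impP=> u' Ruu' pu'; apply/isat_iallP=> t Qu't.
apply/negPn/negP=> nt; have Qtu := umax _ nt (Qt (RQ Ruu') Qu't).
by case/negP: nu; rewrite (cl _ _ Ruu' (Qt Qu't Qtu)).
Qed.

(* A strict R-pair x < y inside a cluster refutes the formula at x when p is
   the complement of the R-downset of x: every point of the cluster below x is
   below y, where p holds while [iall p] fails. *)
Lemma ivalid_casari_clean : ivalid F casari -> clean_clusters.
Proof.
move=> vc x y Rxy Qyx; apply/eqP/negPn/negP=> xy.
have nRyx : ~~ relR y x.
  apply: contra xy => Ryx; case: mF => [[_ anti _] _ _ _ _].
  by apply/eqP; apply: anti; rewrite Rxy.
pose v (n : nat) := [set z | ~~ relR z x].
have vU n : upset (@relR F) (v n).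
  apply/upsetP=> z t Rzt; rewrite !inE; apply: contra; exact: Rt.
have nall t : rel2 t x -> ~ isat v (iall (Var 0)) t.
  by move=> Qtx /isat_iallP /(_ x Qtx) /=; rewrite inE Rr.
apply: (nall x (Qr x)); have /isat_impP := vc v vU x; apply; first exact: Rr.
apply/isat_iallP=> u Qxu; apply/isat_impP=> t Rut /isat_impP H.
apply/isat_iallP=> s Qts /=; rewrite inE; apply/negP=> Rsx.
have Qtx : rel2 t x := Qt Qts (RQ Rsx).
case: (boolP (relR t x)) => Rtx.
  apply: (nall y Qyx); apply: H; first exact: Rt Rxy.
  by rewrite /= inE.
by apply: (nall t Qtx); apply: H; rewrite //= inE.
Qed.

Lemma MpIPC_frameP : mipc_frame_of MpIPC F <-> clean_clusters.
Proof.
split=> [[_ H]|cl]; first by apply/ivalid_casari_clean/H/closure_ax; right.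
have sound A : (forall a, A a -> ivalid F a) -> forall a, Defs.closure inec A a -> ivalid F a.
  move=> AV; apply: closure_sound => // [a b||]; last exact: ivalid_nec.
    exact: ivalid_MP.
  exact: ivalid_subst.
(* [MpIPC] is a closure over the closure [MIPC], so soundness is used once at each level. *)
split=> //; apply: (sound) => a [|->]; last exact: casari_ivalid.
exact: (sound _ MIPC_axiom_ivalid _).
Qed.

End IntuitionisticValidity.

(** * Classical semantics, Grzegorczyk's axiom and the Gödel translation *)

(** For antisymmetric [relR] this is the skeleton before points are replaced by their classes;
    validity is studied here, free of quotients. *)
Definition Q_frame (G : frame) : frame := @Frame G (@relR G) (@relQ G).

Section ModalValidity.
Variable G : frame.
Implicit Types (v : nat -> {set G}) (a b c : mform) (x y z : G).

Lemma msat_boxP v b x :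
  reflect (forall y, relR x y -> msat v b y) (msat v (box b) x).
Proof.
apply: (iffP forallP) => H y; first exact: (implyP (H y)).
by apply/implyP; apply: H.
Qed.

Lemma msat_mallP v b x :
  reflect (forall y, rel2 x y -> msat v b y) (msat v (mall b) x).
Proof.
apply: (iffP forallP) => H y; first exact: (implyP (H y)).
by apply/implyP; apply: H.
Qed.

Lemma msat_impP v b c x :
  reflect (msat v b x -> msat v c x) (msat v (b ==> c)%F x).
Proof. exact: implyP. Qed.

Lemma msat_mexP v b x :
  reflect (exists2 y, rel2 x y & msat v b y) (msat v (mex b) x).
Proof.
rewrite /= negb_forall; apply: (iffP existsP) => -[y].
  by rewrite negb_imply negbK => /andP[]; exists y.
by move=> Exy sy; exists y; rewrite negb_imply negbK Exy.
Qed.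

Lemma msat_subst v s a x :
  msat v (subst s a) x = msat (fun n => [set y | msat v (s n) y]) a x.
Proof.
elim: a x => [n|a IHa b IHb|a IHa b IHb|a IHa b IHb|a IHa|[] a IHa] x /=.
- by rewrite inE.
- by rewrite IHa IHb.
- by rewrite IHa IHb.
- by rewrite IHa IHb.
- by rewrite IHa.
- by apply: eq_forallb => y; rewrite IHa.
- by apply: eq_forallb => y; rewrite IHa.
Qed.

Lemma msat_of_prop v (a : form void) x :
  msat v (of_prop mmod a) x = truth_value (fun n => x \in v n) a.
Proof. by elim: a => [n|a IHa b IHb|a IHa b IHb|a IHa b IHb|a IHa|[]] //=; rewrite ?IHa ?IHb. Qed.

Hypothesis mG : ms4_frame G.

Let Rr : reflexive (@relR G). Proof. by case: mG => [[]]. Qed.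
Let Rt : transitive (@relR G). Proof. by case: mG => [[]]. Qed.
Let Er : reflexive (@rel2 G). Proof. by case: mG => _ []. Qed.
Let Es : symmetric (@rel2 G). Proof. by case: mG => _ []. Qed.
Let Et : transitive (@rel2 G). Proof. by case: mG => _ []. Qed.
Let ERE x y z : rel2 x y -> relR y z -> exists u, relR x u /\ rel2 u z.
Proof. by case: mG => _ _; apply. Qed.

Lemma relQP x y : reflect (exists2 z, relR x z & rel2 z y) (relQ x y).
Proof.
by apply: (iffP existsP) => [[z /andP[? ?]]|[z ? ?]]; exists z => //; apply/andP.
Qed.

Lemma relR_relQ x y : relR x y -> relQ x y.
Proof. by move=> Rxy; apply/relQP; exists y. Qed.

Lemma rel2_relQ x y : rel2 x y -> relQ x y.
Proof. by move=> Exy; apply/relQP; exists x. Qed.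

(** In a path R, E, R, E the inner E-step and R-step are swapped by the commutation condition of
    MS4-frames. *)
Lemma relQ_trans : transitive (@relQ G).
Proof.
move=> y x z /relQP[u Rxu Euy] /relQP[w Ryw Ewz]; apply/relQP.
by have [t [Rut Etw]] := ERE Euy Ryw; exists t; [exact: Rt Rut | exact: Et Ewz].
Qed.

Lemma Q_frame_mipc : antisymmetric (@relR G) -> mipc_frame (Q_frame G).
Proof.
move=> Ra; split=> //.
- by split=> [x|]; [exact: relR_relQ | exact: relQ_trans].
- exact: relR_relQ.
(* A [relQ]-image is closed under [relR], since [relR] is contained in the transitive [relQ]. *)
- move=> U _; apply/upsetP=> y z /relR_relQ Qyz; rewrite !inE.
  case/existsP=> x /andP[xU Qxy]; apply/existsP; exists x; rewrite xU.
  exact: relQ_trans Qyz.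
- move=> x y /relQP[z Rxz Ezy]; exists z; split=> //.
  by apply/andP; split; apply: rel2_relQ; rewrite // Es.
Qed.

Lemma MS4_axiom_mvalid a : MS4_axiom a -> mvalid G a.
Proof.
case=> {a} [a ta|p q|p|p|p q|p|p|p|p] v x; first by rewrite msat_of_prop; apply: ta.
- apply/msat_impP=> /msat_boxP pq; apply/msat_impP=> /msat_boxP vp; apply/msat_boxP=> y Rxy.
  by have /msat_impP := pq _ Rxy; apply; apply: vp.
- by apply/msat_impP=> /msat_boxP; apply.
- apply/msat_impP=> /msat_boxP H; apply/msat_boxP=> y Rxy; apply/msat_boxP=> z Ryz.
  by apply: H; apply: Rt Ryz.
- apply/msat_impP=> /msat_mallP pq; apply/msat_impP=> /msat_mallP vp; apply/msat_mallP=> y Rxy.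
  by have /msat_impP := pq _ Rxy; apply; apply: vp.
- by apply/msat_impP=> /msat_mallP; apply.
- apply/msat_impP=> /msat_mallP H; apply/msat_mallP=> y Rxy; apply/msat_mallP=> z Ryz.
  by apply: H; apply: Et Ryz.
- apply/msat_impP=> /msat_mexP[y Exy py]; apply/msat_mallP=> z Exz; apply/msat_mexP.
  by exists y => //; apply: Et Exy; rewrite Es.
- apply/msat_impP=> /msat_boxP H; apply/msat_mallP=> y Exy; apply/msat_boxP=> z Ryz.
  by have [u [Rxu Euz]] := ERE Exy Ryz; have /msat_mallP := H _ Rxu; apply.
Qed.

(** At an [relR]-maximal failure [y] of p above [x], the formula p -> box p holds at every successor
    [z]: a failure [t] above a point [z] with p would see [y] by maximality, and antisymmetry would
    give [y = z]. The premise then yields p at [y]. *)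
Lemma grz_mvalid : antisymmetric (@relR G) -> mvalid G grz.
Proof.
move=> Ra v x; apply/msat_impP=> /msat_boxP H; apply/negPn/negP=> nx.
have [y [ny Rxy] ymax] := finite_maximal (P := fun y => ~~ msat v (Var 0) y) Rr Rt nx.
case/negP: (ny); have /msat_impP := H _ Rxy; apply.
apply/msat_boxP=> z Ryz; apply/msat_impP=> pz; apply/msat_boxP=> t Rzt.
apply/negPn/negP=> nt; have Rty := ymax _ nt (Rt Ryz Rzt).
by case/negP: ny; rewrite (_ : y = z) //; apply: Ra; rewrite Ryz (Rt Rzt Rty).
Qed.

(** Let p fail only at [x], where [x] and [y] are distinct and see each other. From [x], the
    implication p -> box p breaks at [y], so box (p -> box p) fails at [x], the one point where p
    fails. The premise of the axiom thus holds at [x] and its conclusion does not. *)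
Lemma mvalid_grz_antisymmetric : mvalid G grz -> antisymmetric (@relR G).
Proof.
move=> vg x y /andP[Rxy Ryx]; apply/eqP/negPn/negP=> xy.
pose v (n : nat) := [set~ x]; have pE n z : msat v (Var n) z = (z != x).
  by rewrite /= !inE.
have /msat_impP H := vg v x; have : msat v (Var 0) x; last by rewrite pE eqxx.
apply: H; apply/msat_boxP=> z Rxz; apply/msat_impP=> /msat_boxP H.
rewrite pE; apply/eqP=> zx; subst z.
have /msat_impP := H _ Rxy; rewrite pE eq_sym => /(_ xy)/msat_boxP/(_ _ Ryx).
by rewrite pE eqxx.
Qed.

(** Letters are read through their [relR]-interiors, which are upsets. The block box-forall walks
    along R and then E, which is exactly [relQ]. *)
Lemma goedel_isat v (a : iform) x : antisymmetric (@relR G) ->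
  msat v (goedel a) x = @isat (Q_frame G) (fun n => [set y | msat v (box (Var n)) y]) a x.
Proof.
move=> Ra; set v' := fun n => _; have mQ := Q_frame_mipc Ra.
have vU n : upset (@relR (Q_frame G)) (v' n).
  apply/upsetP=> y z Ryz; rewrite !inE => /msat_boxP H.
  by apply/msat_boxP=> t /(Rt Ryz); apply: H.
elim: a x => [n|a IHa b IHb|a IHa b IHb|a IHa b IHb|a IHa|[] a IHa] x /=.
- by rewrite inE.
- by rewrite IHa IHb.
- by rewrite IHa IHb.
- by apply: eq_forallb => y; rewrite IHa IHb.
- by apply: eq_forallb => y; rewrite IHa.
- apply/(msat_boxP v (mall (goedel a)) x)/forallP=> [H y|H y Rxy].
    apply/implyP=> /relQP[z Rxz Ezy]; rewrite -IHa.
    by have /msat_mallP := H _ Rxz; apply.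
  apply/msat_mallP=> z Eyz; rewrite IHa; apply: (implyP (H z)).
  by apply/relQP; exists y.
(* A cluster of [relQ] can exceed the [rel2]-class. A witness [y] in the cluster of [x] has an
   [relR]-successor [z] in the [rel2]-class of [x], and persistence carries the formula from [y] to
   [z]. *)
- apply/(msat_mexP v (goedel a) x)/(@isat_iexP (Q_frame G) v' a x) => [[y Exy ay]|[y [_ /relQP[z Ryz Ezx] ay]]].
    by exists y; split; rewrite -?IHa //; apply: rel2_relQ; rewrite // Es.
  exists z; first by rewrite Es.
  by rewrite IHa; apply: (@isat_mono (Q_frame G) mQ) ay.
Qed.

(** Interiors of arbitrary valuations range over exactly the upset valuations: an interior is an
    upset, and an upset is its own interior. *)
Lemma goedel_mvalid (a : iform) : antisymmetric (@relR G) ->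
  mvalid G (goedel a) <-> ivalid (Q_frame G) a.
Proof.
move=> Ra; split=> H v; last first.
  move=> x; rewrite goedel_isat //; apply: H => n; apply/upsetP=> y z Ryz.
  rewrite !inE => /msat_boxP Hy; by apply/msat_boxP=> t /(Rt Ryz); apply: Hy.
move=> vU x; have := H v x; rewrite goedel_isat //.
rewrite (@eq_isat _ _ v) // => n; apply/setP=> y; rewrite !inE.
apply/msat_boxP/idP=> [|yv z Ryz]; first exact.
by move/upsetP: (vU n); apply; eauto.
Qed.

(** Antisymmetry comes first, from Grzegorczyk's axiom: it makes [Q_frame G] an MIPC-frame, to which
    the Gödel translation transfers the Casari formula. *)
Lemma MpGrz_frameP : ms4_frame_of MpGrz G <->
  antisymmetric (@relR G) /\ clean_clusters (Q_frame G).
Proof.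
have ax1 A a : A a -> Defs.closure mnec A a by apply: closure_ax.
split=> [[_ H]|[Ra cl]].
  have Ra : antisymmetric (@relR G).
    by apply/mvalid_grz_antisymmetric/H/ax1; left; apply: ax1; right.
  split=> //; apply: ivalid_casari_clean; first exact: Q_frame_mipc.
  by apply/goedel_mvalid => //; apply/H/ax1; right.
have sound A : (forall a, A a -> mvalid G a) -> forall a, Defs.closure mnec A a -> mvalid G a.
  move=> AV; apply: closure_sound => // [a b ab va v x|s a va v x|[] a _ va v x].
  - by have /msat_impP := ab v x; apply; apply: va.
  - by rewrite msat_subst; apply: va.
  - by apply/msat_boxP=> y _; apply: va.
  - by apply/msat_mallP=> y _; apply: va.
split=> //; apply: (sound) => a [|->]; last first.
  by apply/goedel_mvalid=> //; apply: casari_ivalid => //; apply: Q_frame_mipc.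
apply: (sound) => {}a [|->]; last exact: grz_mvalid.
exact: (sound _ MS4_axiom_mvalid _).
Qed.

End ModalValidity.

(** * Passing between the relations Q and E *)

(** An R-step followed by a step in a cluster is a Q-step by transitivity; the converse
    factorisation is the last MIPC-frame condition. *)
Lemma Q_frame_sigma (F : frame) : mipc_frame F ->
  @relQ (sigma_frame F) =2 @rel2 F.
Proof.
case=> _ [_ Qt] RQ _ QRE x y; apply/existsP/idP=> [[z /andP[/RQ Qxz /andP[Qzy _]]]|/QRE].
  exact: Qt Qzy.
by case=> z [Rxz Ezy]; exists z; apply/andP.
Qed.

Lemma sigma_frame_ms4 (F : frame) : mipc_frame F -> ms4_frame (sigma_frame F).
Proof.
case=> [[Rr Ra Rt] [Qr Qt] RQ _ QRE]; split=> //.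
- split=> [x|x y|y x z /andP[Qxy Qyx] /andP[Qyz Qzy]].
  + exact/andP.
  + exact: andbC.
  + by apply/andP; split; [exact: Qt Qyz | exact: Qt Qyx].
- by move=> x y z /andP[Qxy _] /RQ Qyz; apply: QRE; apply: Qt Qyz.
Qed.

Lemma sigma_frame_MpGrz (F : frame) :
  mipc_frame_of MpIPC F -> ms4_frame_of MpGrz (sigma_frame F).
Proof.
move=> mlF; have mF := proj1 mlF; apply/(MpGrz_frameP (sigma_frame_ms4 mF)).
split=> [|x y Rxy]; first by case: mF => [[]].
by rewrite /= Q_frame_sigma //; move/(MpIPC_frameP mF): mlF; apply.
Qed.

(** If x R z E y and y sees x by [relQ], then so does z, and cleanness collapses x and z; what
    remains is x E y. *)
Lemma cluster_relQ (G : frame) : ms4_frame_of MpGrz G ->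
  cluster (@relQ G) =2 @rel2 G.
Proof.
move=> mlG x y; have mG := proj1 mlG; have [_ cl] := (MpGrz_frameP mG).1 mlG.
have Es : symmetric (@rel2 G) by case: mG => _ [].
apply/andP/idP=> [[/relQP[z Rxz Ezy] Qyx]|Exy]; last first.
  by split; apply: rel2_relQ; rewrite // Es.
rewrite (cl x z Rxz) //; apply: relQ_trans Qyx => //; exact: rel2_relQ.
Qed.

(** * Representatives of the classes in a skeleton *)

Section SkeletonRepr.
Variable G : frame.

(** Boolean equality is used because [xchoose] selects a witness of a boolean predicate. *)
Lemma skeleton_proj_surj (A : skeleton G) : exists x, skeleton_proj x == A.
Proof.
by have /imsetP[x _ Ax] := svalP A; exists x; apply/eqP/val_inj/esym.
Qed.

Definition skeleton_repr (A : skeleton G) : G := xchoose (skeleton_proj_surj A).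

Lemma skeleton_reprK : cancel skeleton_repr (@skeleton_proj G).
Proof. by move=> A; apply/eqP/(xchooseP (skeleton_proj_surj A)). Qed.

Hypothesis mlG : ms4_frame_of MpGrz G.

Let mG : ms4_frame G. Proof. by case: mlG. Qed.
Let Ra : antisymmetric (@relR G). Proof. by case: ((MpGrz_frameP mG).1 mlG). Qed.
Let Rr : reflexive (@relR G). Proof. by case: mG => [[]]. Qed.

(** A point and the representative of its class see each other, so antisymmetry identifies them. *)
Lemma skeleton_projK : cancel (@skeleton_proj G) skeleton_repr.
Proof.
move=> x; have := skeleton_reprK (skeleton_proj x) => E; apply: Ra.
by rewrite -!(skeleton_relR mG) E !(skeleton_relR mG) !Rr.
Qed.

Lemma skeleton_repr_relR A B :
  @relR G (skeleton_repr A) (skeleton_repr B) = @relR (skeleton G) A B.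
Proof. by rewrite -(skeleton_relR mG) !skeleton_reprK. Qed.

Lemma skeleton_repr_relQ A B :
  @relQ G (skeleton_repr A) (skeleton_repr B) = @rel2 (skeleton G) A B.
Proof. by rewrite -(skeleton_relQ mG) !skeleton_reprK. Qed.

End SkeletonRepr.

(** * Transport along bijections and a pointwise criterion for MIPC-morphisms *)

Lemma mipc_frame_iso (F1 F2 : frame) (f : F1 -> F2) (g : F2 -> F1) :
  cancel f g -> cancel g f ->
  (forall x y, relR (g x) (g y) = relR x y) ->
  (forall x y, rel2 (g x) (g y) = rel2 x y) ->
  mipc_frame F1 -> mipc_frame F2.
Proof.
move=> fK gK gR gQ [[Rr Ra Rt] [Qr Qt] RQ _ QRE].
have Qt2 : transitive (@rel2 F2) by move=> y x z; rewrite -!gQ; apply: Qt.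
have RQ2 : subrel (@relR F2) (@rel2 F2) by move=> x y; rewrite -gR -gQ; apply: RQ.
split=> //.
- split=> [x|x y|y x z]; rewrite -!gR //; last exact: Rt.
  by move/Ra/(can_inj gK).
- by split=> // x; rewrite -gQ.
- move=> U _; apply/upsetP=> y z /RQ2 Qyz; rewrite !inE.
  by case/existsP=> x /andP[xU Qxy]; apply/existsP; exists x; rewrite xU (Qt2 _ _ _ Qxy).
- move=> x y; rewrite -gQ => /QRE[z [Rxz /andP[Qzy Qyz]]]; exists (f z).
  by rewrite -gR fK; split=> //; apply/andP; rewrite /= -!gQ fK.
Qed.

Lemma p_morphism_bij (X1 X2 : finType) (R1 : rel X1) (R2 : rel X2)
    (f : {ffun X1 -> X2}) (g : X2 -> X1) :
  cancel f g -> cancel g f -> (forall x y, R2 (f x) (f y) = R1 x y) ->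
  p_morphism R1 R2 f.
Proof.
move=> fK gK fR; apply/p_morphismP; split=> [x y|x z]; first by rewrite fR.
by move=> Rz; exists (g z); rewrite ?gK // -fR gK.
Qed.

Lemma ms4_morphism_bij (G1 G2 : frame) (f : {ffun G1 -> G2}) (g : G2 -> G1) :
  cancel f g -> cancel g f ->
  (forall x y, relR (f x) (f y) = relR x y) ->
  (forall x y, rel2 (f x) (f y) = rel2 x y) ->
  ms4_morphism f.
Proof. by move=> fK gK fR fE; apply/andP; split; apply: (p_morphism_bij fK gK). Qed.

(** The third clause is one inclusion of the preimage condition. The other follows from preservation
    of [rel2], the inclusion of [relR] in [rel2] and transitivity. *)
Lemma mipc_morphismP (F1 F2 : frame) (f : {ffun F1 -> F2}) : mipc_frame F2 ->
  reflect [/\ p_morphism (@relR F1) (@relR F2) f,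
              p_morphism (@rel2 F1) (@rel2 F2) f
            & forall x z, rel2 z (f x) -> exists2 w, rel2 w x & relR z (f w)]
          (mipc_morphism f).
Proof.
move=> [_ [_ Qt] RQ _ _]; apply: (iffP and3P) => -[fR fQ H]; split=> //.
  move=> x z Qz; have := eqP (forallP H x) => /setP/(_ z).
  rewrite rpreimage1P Qz inE => /esym/existsP[_ /andP[/imsetP[w wx ->] Rzw]].
  by exists w => //; rewrite -rpreimage1P.
apply/forallP=> x; apply/eqP/setP=> z; rewrite rpreimage1P inE.
apply/idP/existsP=> [/H[w Qwx Rzw]|[_ /andP[/imsetP[w + ->] /RQ Qzw]]].
  by exists (f w); rewrite imset_f // rpreimage1P.
by rewrite rpreimage1P => Qwx; apply: Qt Qzw _; case/p_morphismP: fQ => + _; apply.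
Qed.

Lemma mipc_morphism_bij (F1 F2 : frame) (f : {ffun F1 -> F2}) (g : F2 -> F1) :
  mipc_frame F2 -> cancel f g -> cancel g f ->
  (forall x y, relR (f x) (f y) = relR x y) ->
  (forall x y, rel2 (f x) (f y) = rel2 x y) ->
  mipc_morphism f.
Proof.
move=> mF2 fK gK fR fQ; apply/(mipc_morphismP _ mF2).
split; [exact: (p_morphism_bij fK gK)|exact: (p_morphism_bij fK gK)|] => x z Qz.
exists (g z); first by rewrite -fQ gK.
by rewrite gK; case: mF2 => [[]].
Qed.

(** * The skeleton and sigma on objects and morphisms *)

Lemma skeleton_mipc (G : frame) : ms4_frame_of MpGrz G -> mipc_frame (skeleton G).
Proof.
move=> mlG; have [mG [Ra _]] := (proj1 mlG, (MpGrz_frameP (proj1 mlG)).1 mlG).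
apply: (@mipc_frame_iso (Q_frame G) _ _ _ (skeleton_projK mlG) (@skeleton_reprK G)).
- exact: (skeleton_repr_relR mlG).
- exact: (skeleton_repr_relQ mlG).
- exact: Q_frame_mipc.
Qed.

Lemma skeleton_MpIPC (G : frame) :
  ms4_frame_of MpGrz G -> mipc_frame_of MpIPC (skeleton G).
Proof.
move=> mlG; apply/(MpIPC_frameP (skeleton_mipc mlG)) => A B.
have [_ cl] := (MpGrz_frameP (proj1 mlG)).1 mlG.
rewrite -(skeleton_repr_relR mlG) -(skeleton_repr_relQ mlG) => RAB QBA.
exact: can_inj (@skeleton_reprK G) _ _ (cl _ _ RAB QBA).
Qed.

Lemma skeleton_repr_morphism (G : frame) : ms4_frame_of MpGrz G ->
  @mipc_morphism (skeleton G) (Q_frame G) [ffun A => skeleton_repr A].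
Proof.
move=> mlG; have [mG [Ra _]] := (proj1 mlG, (MpGrz_frameP (proj1 mlG)).1 mlG).
apply: (@mipc_morphism_bij (skeleton G) (Q_frame G) _ (@skeleton_proj G))
  => [|A|x|A B|A B]; rewrite ?ffunE.
- exact: Q_frame_mipc.
- exact: skeleton_reprK.
- exact: (skeleton_projK mlG).
- exact: (skeleton_repr_relR mlG).
- exact: (skeleton_repr_relQ mlG).
Qed.

Lemma skeleton_proj_morphism (G : frame) : ms4_frame_of MpGrz G ->
  @mipc_morphism (Q_frame G) (skeleton G) [ffun x => @skeleton_proj G x].
Proof.
move=> mlG; have mG := proj1 mlG.
apply: (@mipc_morphism_bij (Q_frame G) (skeleton G) _ (@skeleton_repr G))
  => [|x|A|x y|x y]; rewrite ?ffunE.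
- exact: skeleton_mipc.
- exact: (skeleton_projK mlG).
- exact: skeleton_reprK.
- exact: (skeleton_relR mG).
- exact: (skeleton_relQ mG).
Qed.

(** Choosing representatives defines the map for any function [f]. On M+Grz-frames [skeleton_projK]
    shows that it sends the class of x to the class of f x. *)
Definition skeleton_map (G1 G2 : frame) (f : {ffun G1 -> G2}) :
    {ffun skeleton G1 -> skeleton G2} :=
  [ffun A => skeleton_proj (f (skeleton_repr A))].

(** The map [f] is an MIPC-morphism between the Q-frames, and the skeleton map is [f] conjugated by
    the isomorphisms between Q-frames and skeletons. *)
Lemma skeleton_map_morphism (G1 G2 : frame) (f : {ffun G1 -> G2}) :
  ms4_frame_of MpGrz G1 -> ms4_frame_of MpGrz G2 ->
  ms4_morphism f -> mipc_morphism (skeleton_map f).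
Proof.
move=> ml1 ml2 /andP[fR fE].
have [m1 m2] := (proj1 ml1, proj1 ml2).
have [[Ra1 _] [Ra2 _]] := ((MpGrz_frameP m1).1 ml1, (MpGrz_frameP m2).1 ml2).
have [mQ1 mQ2] := (Q_frame_mipc m1 Ra1, Q_frame_mipc m2 Ra2).
have [_ [_ Es2 _] _] := m2.
have Es1 : symmetric (@rel2 G1) by case: m1 => _ [].
have fQ : @mipc_morphism (Q_frame G1) (Q_frame G2) f.
  have [fR1 fR2] := p_morphismP _ _ _ fR; have [fE1 fE2] := p_morphismP _ _ _ fE.
  apply/mipc_morphismP => //; split=> // [|x z /relQP[u Rzu]].
    apply/p_morphismP; split=> [x y /relQP[z Rxz Ezy]|x z /relQP[u /fR2[w Rxw ->]]].
      by apply/relQP; exists (f z); auto.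
    by case/fE2=> y Ewy ->; exists y => //; apply/relQP; exists w.
  (* From z R u E f x, the back condition for E lifts [u] to a point [w] in the class of [x], which
     is the required preimage. *)
  rewrite Es2 => /fE2[w Exw uw]; exists w; last by rewrite -uw.
  by apply: rel2_relQ; rewrite // Es1.
have := mipc_morphism_comp mQ2 (skeleton_mipc ml2)
  (skeleton_proj_morphism ml2) (mipc_morphism_comp mQ1 mQ2 fQ
  (skeleton_repr_morphism ml1)).
by congr (mipc_morphism _); apply/ffunP=> A; rewrite !ffunE.
Qed.

Lemma sigma_morphism (F1 F2 : frame) (f : {ffun F1 -> F2}) :
  mipc_frame_of MpIPC F1 -> mipc_frame_of MpIPC F2 -> mipc_morphism f ->
  @ms4_morphism (sigma_frame F1) (sigma_frame F2) f.
Proof.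
move=> ml1 ml2 /(mipc_morphismP _ (proj1 ml2))[fR fQ fI]; apply/andP; split=> //.
have cl := (MpIPC_frameP (proj1 ml2)).1 ml2.
have [_ [_ Qt1] RQ1 _ QRE1] := proj1 ml1; have [_ [_ Qt2] _ _ _] := proj1 ml2.
have [fR1 _] := p_morphismP _ _ _ fR; have [fQ1 _] := p_morphismP _ _ _ fQ.
apply/p_morphismP; split=> [x y /andP[Qxy Qyx]|x z /andP[Qxz Qzx]].
  by apply/andP; split; apply: fQ1.
(* A point w below x with z R f(w) is moved up to w' in the cluster of x;
   then z R f(w') inside one cluster, so z = f(w'). *)
have [w Qwx Rzw] := fI x z Qzx; have [w' [Rww' /andP[Qw'x Qxw']]] := QRE1 _ _ Qwx.
have [_ _ RQ2 _ _] := proj1 ml2; have [[_ _ Rt2] _ _ _ _] := proj1 ml2.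
exists w'; first exact/andP.
apply: cl; first exact: Rt2 (fR1 _ _ Rww').
exact: Qt2 (fQ1 _ _ Qw'x) Qxz.
Qed.

(** * The functors [rho] and [sigma] *)

Lemma fin_mipc_iso L (F1 F2 : Fin_MIPC L) (h : hom F1 F2) (k : hom F2 F1) :
  cancel (sval h) (sval k) -> cancel (sval k) (sval h) -> isomorphism h.
Proof.
by move=> hK kK; exists k; split; apply: val_inj; apply/ffunP=> x; rewrite !ffunE.
Qed.

Lemma fin_ms4_iso L (G1 G2 : Fin_MS4 L) (h : hom G1 G2) (k : hom G2 G1) :
  cancel (sval h) (sval k) -> cancel (sval k) (sval h) -> isomorphism h.
Proof.
by move=> hK kK; exists k; split; apply: val_inj; apply/ffunP=> x; rewrite !ffunE.
Qed.

Definition rho_obj (G : Fin_MpGrz) : Fin_MpIPC :=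
  exist _ (skeleton (sval G)) (skeleton_MpIPC (svalP G)).

Definition rho_hom (G1 G2 : Fin_MpGrz) (f : hom G1 G2) : hom (rho_obj G1) (rho_obj G2) :=
  exist (fun f => is_true (mipc_morphism f)) _
    (skeleton_map_morphism (svalP G1) (svalP G2) (svalP f)).

Lemma rho_hom_id (G : Fin_MpGrz) : rho_hom (idm G) = idm (rho_obj G).
Proof. by apply: val_inj; apply/ffunP=> A; rewrite !ffunE skeleton_reprK. Qed.

Lemma rho_hom_comp (G1 G2 G3 : Fin_MpGrz) (g : hom G2 G3) (f : hom G1 G2) :
  rho_hom (Defs.comp g f) = Defs.comp (rho_hom g) (rho_hom f).
Proof.
apply: val_inj; apply/ffunP=> A; rewrite !ffunE.
by rewrite (skeleton_projK (svalP G2)).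
Qed.

Definition rho : functor Fin_MpGrz Fin_MpIPC rho_obj :=
  Functor rho_hom_id rho_hom_comp.

Definition sigma_obj (F : Fin_MpIPC) : Fin_MpGrz :=
  exist _ (sigma_frame (sval F)) (sigma_frame_MpGrz (svalP F)).

Definition sigma_hom (F1 F2 : Fin_MpIPC) (f : hom F1 F2) :
    hom (sigma_obj F1) (sigma_obj F2) :=
  exist (fun f => is_true (ms4_morphism f)) _
    (sigma_morphism (svalP F1) (svalP F2) (svalP f)).

Lemma sigma_hom_id (F : Fin_MpIPC) : sigma_hom (idm F) = idm (sigma_obj F).
Proof. exact: val_inj. Qed.

Lemma sigma_hom_comp (F1 F2 F3 : Fin_MpIPC) (g : hom F2 F3) (f : hom F1 F2) :
  sigma_hom (Defs.comp g f) = Defs.comp (sigma_hom g) (sigma_hom f).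
Proof. exact: val_inj. Qed.

Definition sigma : functor Fin_MpIPC Fin_MpGrz sigma_obj :=
  Functor sigma_hom_id sigma_hom_comp.

(** * Components of the natural isomorphisms with the identity functors *)

Lemma sigma_rho_repr_morphism (G : frame) : ms4_frame_of MpGrz G ->
  @ms4_morphism (sigma_frame (skeleton G)) G [ffun A => skeleton_repr A].
Proof.
move=> mlG; apply: (@ms4_morphism_bij (sigma_frame (skeleton G)) G _ (@skeleton_proj G))
  => [A|x|A B|A B]; rewrite !ffunE.
- exact: skeleton_reprK.
- exact: (skeleton_projK mlG).
- exact: (skeleton_repr_relR mlG).
(* Once E is written as the cluster relation of [relQ], both sides are conjunctions of the two
   directions of Q. *)
- rewrite -(cluster_relQ mlG).
  exact: (congr2 andb (skeleton_repr_relQ mlG A B) (skeleton_repr_relQ mlG B A)).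
Qed.

Lemma sigma_rho_proj_morphism (G : frame) : ms4_frame_of MpGrz G ->
  @ms4_morphism G (sigma_frame (skeleton G)) [ffun x => skeleton_proj x].
Proof.
move=> mlG; apply: (@ms4_morphism_bij G (sigma_frame (skeleton G)) _ (@skeleton_repr G))
  => [x|A|x y|x y]; rewrite !ffunE.
- exact: (skeleton_projK mlG).
- exact: skeleton_reprK.
- exact: (skeleton_relR (proj1 mlG)).
- rewrite -(cluster_relQ mlG).
  exact: (congr2 andb (skeleton_relQ (proj1 mlG) x y) (skeleton_relQ (proj1 mlG) y x)).
Qed.

Lemma rho_sigma_repr_morphism (F : frame) : mipc_frame_of MpIPC F ->
  @mipc_morphism (skeleton (sigma_frame F)) F [ffun A => skeleton_repr A].
Proof.
move=> mlF; have mlG := sigma_frame_MpGrz mlF; have mF := proj1 mlF.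
apply: (@mipc_morphism_bij (skeleton (sigma_frame F)) F _ (@skeleton_proj (sigma_frame F)))
  => // [A|x|A B|A B]; rewrite !ffunE.
- exact: skeleton_reprK.
- exact: (skeleton_projK mlG).
- exact: (skeleton_repr_relR mlG).
- by rewrite -Q_frame_sigma // (skeleton_repr_relQ mlG).
Qed.

Lemma rho_sigma_proj_morphism (F : frame) : mipc_frame_of MpIPC F ->
  @mipc_morphism F (skeleton (sigma_frame F))
    [ffun x => @skeleton_proj (sigma_frame F) x].
Proof.
move=> mlF; have mlG := sigma_frame_MpGrz mlF; have mF := proj1 mlF.
apply: (@mipc_morphism_bij F (skeleton (sigma_frame F)) _ (@skeleton_repr (sigma_frame F)))
  => [|x|A|x y|x y]; rewrite ?ffunE.
- exact: skeleton_mipc.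
- exact: (skeleton_projK mlG).
- exact: skeleton_reprK.
- exact: (skeleton_relR (proj1 mlG)).
- by rewrite (skeleton_relQ (proj1 mlG)) Q_frame_sigma.
Qed.

Definition sigma_rho_repr (G : Fin_MpGrz) : hom (sigma_obj (rho_obj G)) G :=
  exist (fun f => is_true (ms4_morphism f)) _ (sigma_rho_repr_morphism (svalP G)).

Definition sigma_rho_proj (G : Fin_MpGrz) : hom G (sigma_obj (rho_obj G)) :=
  exist (fun f => is_true (ms4_morphism f)) _ (sigma_rho_proj_morphism (svalP G)).

Definition rho_sigma_repr (F : Fin_MpIPC) : hom (rho_obj (sigma_obj F)) F :=
  exist (fun f => is_true (mipc_morphism f)) _ (rho_sigma_repr_morphism (svalP F)).

Definition rho_sigma_proj (F : Fin_MpIPC) : hom F (rho_obj (sigma_obj F)) :=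
  exist (fun f => is_true (mipc_morphism f)) _ (rho_sigma_proj_morphism (svalP F)).

Theorem theorem5p13 :
  exists (rho_ok : forall G : Fin_MpGrz, mipc_frame_of MpIPC (skeleton (sval G)))
         (sigma_ok : forall F : Fin_MpIPC, ms4_frame_of MpGrz (sigma_frame (sval F)))
         (rho : functor Fin_MpGrz Fin_MpIPC
                  (fun G => exist _ (skeleton (sval G)) (rho_ok G)))
         (sigma : functor Fin_MpIPC Fin_MpGrz
                  (fun F => exist _ (sigma_frame (sval F)) (sigma_ok F))),
    [/\ forall (G1 G2 : Fin_MpGrz) (f : hom G1 G2) (x : sval G1),
          sval (fmap rho f) (skeleton_proj x) = skeleton_proj (sval f x),
        forall (F1 F2 : Fin_MpIPC) (f : hom F1 F2) (x : sval F1),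
          sval (fmap sigma f) x = sval f x
      & equivalence_of_categories rho sigma].
Proof.
(* The object maps [rho_obj] and [sigma_obj] are convertible to those in the statement. *)
exists (fun G => skeleton_MpIPC (svalP G)), (fun F => sigma_frame_MpGrz (svalP F)), rho, sigma.
split=> [G1 G2 f x|//|].
  by rewrite ffunE (skeleton_projK (svalP G1)).
split.
- exists sigma_rho_repr; split=> [G|G1 G2 f].
    apply: (fin_ms4_iso (k := sigma_rho_proj G)) => [A|x]; rewrite !ffunE.
      exact: skeleton_reprK.
    exact: (skeleton_projK (svalP G)).
  (* Naturality at [A] says that f (repr A) equals the representative of its own class. *)
  by apply: val_inj; apply/ffunP=> A; rewrite !ffunE (skeleton_projK (svalP G2)).
- exists rho_sigma_repr; split=> [F|F1 F2 f].
    apply: (fin_mipc_iso (k := rho_sigma_proj F)) => [A|x]; rewrite !ffunE.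
      exact: skeleton_reprK.
    exact: (skeleton_projK (sigma_frame_MpGrz (svalP F))).
  apply: val_inj; apply/ffunP=> A; rewrite !ffunE.
  by rewrite (skeleton_projK (sigma_frame_MpGrz (svalP F2))).
Qed.
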